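(* For every $c>0$, every $\lambda\ge1$ and every one of the six models (Independent set, MAX-CUT, anti-ferromagnetic Ising, $q$-Coloring, K-SAT, NAE-K-SAT), there exists a (model dependent) $z(c)$ such that $$\lim_{N\to\infty}N^{-1}\log Z\big(\mathbb{G}(N,\lfloor cN\rfloor)\big)=z(c)$$ with high probability (in probability), where $z(c)$ is a Lipschitz continuous function of $c$. Moreover $z(c)$ is non-decreasing in $c$ for the MAX-CUT, Coloring, K-SAT and NAE-K-SAT models and non-increasing in $c$ for the Independent set model.
   Context: Let $K\ge 2$, $\chi=\{0,\dots,q-1\}$, $[N]=\{1,\dots,N\}$. $\mathbb{G}(N,M)$: $M$ directed hyperedges chosen independently and uniformly at random (with replacement) from $[N]^K$. For a hypergraph $G=([N],E)$ with node potentials $H_i:\chi\to\mathbb{R}$ and edge potentials $H_e:\chi^K\to\mathbb{R}\cup\{-\infty\}$, $H(x)=\sum_iH_i(x_i)+\sum_{e\in E}H_e(x_e)$ for $x\in\chi^N$, and the partition function is $Z(G)=\sum_{x\in\chi^N}\lambda^{H(x)}$ with $\lambda^{-\infty}=0$. Models: Independent set ($K=2,q=2$, $H_i(1)=1,H_i(0)=0$, $H_e(1,1)=-\infty$, else $0$); MAX-CUT ($K=2,q=2$, $H_i\equiv0$, $H_e(x,y)=\mathbf 1[x\ne y]$); anti-ferromagnetic Ising ($K=2,q=2$, fixed $\beta>0,B\in\mathbb{R}$, $H_i(0)=-B,H_i(1)=B$, $H_e(x,y)=-\beta$ if $x=y$, $\beta$ if $x\neq y$); $q$-Coloring ($K=2$,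 $H_i\equiv0$, $H_e(x,y)=\mathbf 1[x\ne y]$); K-SAT ($q=2$, $H_i\equiv0$, independent uniform $a_e\in\{0,1\}^K$ per hyperedge, $H_e(a_e)=0$, $H_e=1$ otherwise); NAE-K-SAT (same but $H_e(a_e)=H_e(\mathbf1-a_e)=0$, $1$ otherwise). *)

(* Defs.v *)
From HB Require Import structures.
From mathcomp Require Import all_boot all_order all_algebra.
From mathcomp Require Import all_classical all_reals all_analysis.
Set Implicit Arguments. Unset Strict Implicit. Unset Printing Implicit Defensive.
Import Order.TTheory GRing.Theory Num.Theory.
Local Open Scope ring_scope.

Section Models.
Variable R : realType.

(* The six models. Ising carries (beta, B); Coloring carries q; the SAT
   models carry K. *)
Inductive model :=
| IndSet | MaxCut | Ising of R & R | Coloring of nat | KSAT of nat | NAESAT of nat.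

Definition mK (m : model) : nat :=
  match m with KSAT K | NAESAT K => K | _ => 2 end.
Definition mq (m : model) : nat :=
  match m with Coloring q => q | _ => 2 end.

Definition wf_model (m : model) : Prop :=
  match m with
  | Ising beta _ => 0 < beta
  | Coloring q => (2 <= q)%N
  | KSAT K | NAESAT K => (2 <= K)%N
  | _ => True
  end.

Definition node_pot (m : model) (x : 'I_(mq m)) : R :=
  match m with
  | IndSet => if val x == 1%N then 1 else 0
  | Ising _ B => if val x == 1%N then B else - B
  | _ => 0
  end.

(* edge potential H_e(a_e, x_e); None stands for -infinity.
   a_e is the random sign vector (only used by K-SAT / NAE-K-SAT). *)
Definition edge_pot (m : model) :
  {ffun 'I_(mK m) -> bool} -> {ffun 'I_(mK m) -> 'I_(mq m)} -> option R :=
  match m as m0 return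
    {ffun 'I_(mK m0) -> bool} -> {ffun 'I_(mK m0) -> 'I_(mq m0)} -> option R
  with
  | IndSet => fun _ y =>
      if (val (y ord0) == 1%N) && (val (y ord_max) == 1%N) then None else Some 0
  | MaxCut => fun _ y => Some (if y ord0 != y ord_max then 1 else 0)
  | Ising beta _ => fun _ y => Some (if y ord0 == y ord_max then - beta else beta)
  | Coloring _ => fun _ y => Some (if y ord0 != y ord_max then 1 else 0)
  | KSAT _ => fun a y =>
      Some (if [forall i, val (y i) == nat_of_bool (a i)] then 0 else 1)
  | NAESAT _ => fun a y =>
      Some (if [forall i, val (y i) == nat_of_bool (a i)]
               || [forall i, val (y i) == nat_of_bool (~~ a i)] then 0 else 1)
  end.

(* A sample of G(N,M) (together with independent uniform signs a_e):
   M directed hyperedges e : [N]^K, each with a sign vector a_e : {0,1}^K. *)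
Definition sample (m : model) (N M : nat) : finType :=
  {ffun 'I_M -> {ffun 'I_(mK m) -> 'I_N} * {ffun 'I_(mK m) -> bool}}.

(* Hamiltonian H(x); None stands for -infinity *)
Definition hamiltonian (m : model) (N M : nat) (g : sample m N M)
    (x : {ffun 'I_N -> 'I_(mq m)}) : option R :=
  let pe := fun e : 'I_M => edge_pot (g e).2 [ffun j => x ((g e).1 j)] in
  if [exists e, pe e == None] then None
  else Some (\sum_(i < N) node_pot (x i) + \sum_(e < M) odflt 0 (pe e)).

(* Zpart function Z(G) = sum_x lambda^{H(x)}, lambda^{-oo} = 0 *)
Definition Zpart (m : model) (lambda : R) (N M : nat) (g : sample m N M) : R :=
  \sum_(x : {ffun 'I_N -> 'I_(mq m)})
     match hamiltonian g x with None => 0 | Some h => lambda `^ h end.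

Definition uprob (m : model) (N M : nat) (E : pred (sample m N M)) : R :=
  #|[set g | E g]|%:R / #|{: sample m N M}|%:R.

Definition nedges (c : R) (N : nat) : nat := Num.truncn (c * N%:R).

Definition nondecr_model (m : model) : bool :=
  match m with MaxCut | Coloring _ | KSAT _ | NAESAT _ => true | _ => false end.
Definition nonincr_model (m : model) : bool :=
  match m with IndSet => true | _ => false end.

End Models.

(* Main.v *)
Require Import Defs.
From HB Require Import structures.
From mathcomp Require Import all_boot all_order all_algebra.
From mathcomp Require Import all_classical all_reals all_analysis.
From mathcomp Require Import ring lra.
Set Implicit Arguments. Unset Strict Implicit. Unset Printing Implicit Defensive.
Import Order.TTheory GRing.Theory Num.Theory numFieldNormedType.Exports.
Local Open Scope ring_scope.
Local Open Scope classical_set_scope.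

(* Interpolation method. Splitting the vertex set in two blocks, replace one by one the
   hyperedges that are uniform on [N]^K by hyperedges that are uniform on a random block
   (block j being chosen with probability N_j / N). Each edge weight has the form
   w0 (1 - theta sum_t prod_i phi_t(a_i, x_i)), so expanding ln(1 - u) in powers of the Gibbs
   average u and writing u^k as an average over k replicas, the mean over a uniform
   hyperedge becomes a combination with nonnegative coefficients of K-th powers of empirical
   frequencies; convexity of the K-th power shows that E ln Z can only decrease.
   Hence E ln Z(N, M) is superadditive up to a binomial splitting of M, whose fluctuations
   are absorbed by the Lipschitz dependence on M. Cutting N into many blocks of a fixed
   size n (rather than in two halves) gives
   liminf_N E ln Z(N) / N >= E ln Z(n) / n - o(1) as n -> oo, hence the limit exists.
   Concentration follows from a variance bound, linear in M, by Chebyshev's inequality. *)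

(** * Power series of the logarithm *)

(** Mean value theorem on [[0, t]] for the remainder, which vanishes at 0 and whose derivative is
    the geometric tail [- x ^+ n / (1 - x)]. *)
Lemma ln_partial_sum (R : realType) (t : R) (n : nat) : 0 <= t -> t < 1 ->
  `| ln (1 - t) + \sum_(k < n) t ^+ k.+1 / k.+1%:R | <= t ^+ n.+1 / (1 - t).
Proof.
move=> t0 t1.
pose f (x : R) : R := ln (1 - x) + \sum_(k < n) x ^+ k.+1 / k.+1%:R.
pose df (x : R) : R := - (1 - x)^-1 + \sum_(k < n) x ^+ k.
have dfE x : x < 1 -> df x = - (x ^+ n / (1 - x)).
  move=> x1; have x1' : 1 - x != 0 by rewrite subr_eq0 gt_eqF.
  apply: (mulIf x1'); rewrite /df mulrDl !mulNr mulVf// divfK//.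
  by rewrite mulrC -opprB mulNr -subrX1; ring.
have dsum (x : R) : is_derive x 1 (fun x : R => \sum_(k < n) x ^+ k.+1 / k.+1%:R : R)
    (\sum_(k < n) x ^+ k).
  elim: n {f df dfE} => [|n IH].
    rewrite big_ord0 (_ : (fun _ => _) = cst 0); last first.
      by apply/funext => y; rewrite big_ord0.
    exact: is_derive_cst.
  rewrite big_ord_recr /= (_ : (fun _ => _) = (fun x : R => \sum_(k < n) x ^+ k.+1 / k.+1%:R) +
      (fun x : R => x ^+ n.+1 / n.+1%:R)); last first.
    by apply/funext => y; rewrite big_ord_recr.
  apply: is_deriveD.
  rewrite (_ : (fun _ => _) = n.+1%:R^-1 *: ((id : R -> R) ^+ n.+1)); last first.
    have idX k (y : R) : ((id : R -> R) ^+ k) y = y ^+ k.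
      by elim: k => // k IHk; rewrite !exprS -IHk.
    by apply/funext => y; rewrite mulrC -idX.
  apply: is_derive_eq.
  by rewrite !scaler1 /= /GRing.scale /= mulrA mulVf ?mul1r// pnatr_eq0.
have fd x : x \in `[0, t]%R -> is_derive x 1 f (df x).
  rewrite in_itv /= => /andP[x0 xt].
  rewrite /f /df; apply: is_deriveD.
  have ? : 0 < 1 - x by rewrite subr_gt0 (le_lt_trans xt).
  have := @is_derive1_comp R (@ln R) (fun x : R => 1 - x) x (1 - x)^-1 (-1).
  rewrite mulrN1; apply; first exact: is_derive1_ln.
  rewrite -[X in is_derive _ _ _ X]sub0r; apply: is_deriveB.
have fc : {within `[0, t], continuous f}.
  by apply: derivable_within_continuous => y /fd [].
have fo x : x \in `]0, t[%R -> is_derive x 1 f (df x).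
  by move=> xt; apply: fd; apply: subset_itv_oo_cc xt.
have f0 : f 0 = 0.
  rewrite /f subr0 ln1 add0r big1// => k _; by rewrite expr0n /= mul0r.
have ft : f t = ln (1 - t) + \sum_(k < n) t ^+ k.+1 / k.+1%:R by [].
clearbody f df.
have [c] := MVT_segment t0 fo fc.
rewrite in_itv /= => /andP[c0 ct] fE.
have c1 : c < 1 by apply: le_lt_trans t1.
have u0 : 0 < 1 - t by rewrite subr_gt0.
have v0 : 0 < 1 - c by rewrite subr_gt0.
rewrite f0 !subr0 dfE// in fE.
have cn : 0 <= c ^+ n by rewrite exprn_ge0.
rewrite -ft fE mulNr normrN ger0_norm; last by rewrite mulr_ge0// divr_ge0// ltW.
rewrite exprSr mulrAC ler_pM ?invr_ge0 ?mulr_ge0 ?(ltW v0)//.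
  by rewrite ler_wpM2r// lerXn2r.
by rewrite lef_pV2// lerB.
Qed.

Lemma ln_partial_sum_cvg (R : realType) (t : R) : 0 <= t -> t < 1 ->
  (fun n => \sum_(k < n) t ^+ k.+1 / k.+1%:R) @ \oo --> - ln (1 - t).
Proof.
move=> t0 t1.
have cv : (fun n => t ^+ n.+1 / (1 - t)) @ \oo --> (0 : R).
  rewrite -[X in _ --> X](mul0r (1 - t)^-1).
  apply: cvgMr_tmp; rewrite (_ : (fun n => t ^+ n.+1) = [sequence t ^+ n.+1]_n)//.
  rewrite (cvg_shiftS (fun n => t ^+ n)); apply: cvg_expr; by rewrite ger0_norm.
apply/cvgrPdist_le => e e0.
move/cvgrPdist_le : cv => /(_ e e0) [N _ HN].
exists N => // n /HN /=; rewrite sub0r normrN => h.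
rewrite -opprD normrN.
apply: le_trans h; apply: le_trans (ler_norm _).
exact: ln_partial_sum.
Qed.

(** The expansion of [- ln (1 - u)] has nonnegative coefficients [1 / k] and no constant term, so an
    inequality between all positive moments passes to the partial sums, then to their limits. *)
Lemma ln_moment_compare (R : realType) (I J : finType) (p t : I -> R) (q r : J -> R) :
  (forall i, 0 <= t i < 1) -> (forall j, 0 <= r j < 1) ->
  (forall k, \sum_i p i * t i ^+ k.+1 <= \sum_j q j * r j ^+ k.+1) ->
  \sum_j q j * ln (1 - r j) <= \sum_i p i * ln (1 - t i).
Proof.
move=> ht hr hm; rewrite -lerN2 -!sumrN.
have E (A : finType) (a s : A -> R) : (forall i, 0 <= s i < 1) ->
  (fun n => \sum_(k < n) (\sum_i a i * s i ^+ k.+1) / k.+1%:R) @ \oo -->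
     \sum_i - (a i * ln (1 - s i)).
  move=> hs.
  rewrite (_ : (fun n => _) = \sum_i (fun n => a i * \sum_(k < n) s i ^+ k.+1 / k.+1%:R)).
    apply: (big_ind2 (fun (f : nat -> R) l => f @ \oo --> l)) => [|f a' g b' fa gb|i _]; [exact: cvg_cst | exact: cvgD |].
    rewrite -mulrN; apply: cvgMl_tmp; apply: ln_partial_sum_cvg;
    by case/andP: (hs i).
  apply/funext => n; rewrite fct_sumE.
  under eq_bigr do rewrite mulr_suml.
  rewrite exchange_big /=; apply: eq_bigr => i _; rewrite mulr_sumr.
  by apply: eq_bigr => k _; rewrite mulrA.
apply: ler_cvg_to (E _ _ _ ht) (E _ _ _ hr) _.
apply: nearW => n; apply: ler_sum => k _; apply: ler_wpM2r => //.
Qed.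

(** * Replica convexity *)

Section Replicas.
Variable R : realType.
Implicit Types (E V : finType) (K k : nat).

Definition mean E (f : E -> R) : R := (\sum_e f e) / #|E|%:R.

Definition hedge K V : finType := ({ffun 'I_K -> V} * {ffun 'I_K -> bool})%type.

Definition map_hedge K V V' (j : V -> V') (e : hedge K V) : hedge K V' :=
  ([ffun i => j (e.1 i)], e.2).

Lemma card_hedge K V : #|{: hedge K V}| = ((#|V| * 2) ^ K)%N.
Proof. by rewrite card_prod !card_ffun card_ord card_bool expnMn. Qed.

(* The pairs (vertex, sign) of a uniform signed hyperedge are independent and uniform. *)
Definition slot_mean V (h : V -> bool -> R) : R :=
  (\sum_v \sum_b h v b) / (#|V| * 2)%:R.

Lemma mean_hedge_prod K V (h : V -> bool -> R) :
  mean (fun e : hedge K V => \prod_i h (e.1 i) (e.2 i)) = slot_mean h ^+ K.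
Proof.
rewrite /mean /slot_mean card_hedge natrX expr_div_n; congr (_ / _).
rewrite -[X in _ ^+ X]card_ord -prodr_const bigA_distr_bigA /=.
rewrite -(pair_bigA _ (fun (v : {ffun 'I_K -> V}) (a : {ffun 'I_K -> bool}) => \prod_i h (v i) (a i))) /=.
by apply: eq_bigr => v _; rewrite bigA_distr_bigA.
Qed.

(* The [k] replicas are the values of [f]. *)
Lemma mean_power_replicas K V k (Xi : finType) (nu : Xi -> R) (g : Xi -> V -> bool -> R) :
  mean (fun e : hedge K V => (\sum_xi nu xi * \prod_i g xi (e.1 i) (e.2 i)) ^+ k) =
  \sum_(f : {ffun 'I_k -> Xi}) (\prod_l nu (f l)) *
     slot_mean (fun v b => \prod_l g (f l) v b) ^+ K.
Proof.
under eq_bigr do rewrite -mean_hedge_prod /mean mulrA mulr_sumr.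
rewrite -mulr_suml /mean; congr (_ / _).
rewrite exchange_big /=; apply: eq_bigr => e _.
rewrite -[X in _ ^+ X]card_ord -prodr_const bigA_distr_bigA /=.
apply: eq_bigr => f _; rewrite big_split /=; congr (_ * _).
by rewrite exchange_big.
Qed.

(** In the induction step the gap is [p (1 - p) (a - b) (a ^+ k - b ^+ k)], whose last two factors
    have the same sign. *)
Lemma convex_power k (p a b : R) : 0 <= p <= 1 -> 0 <= a -> 0 <= b ->
  (p * a + (1 - p) * b) ^+ k <= p * a ^+ k + (1 - p) * b ^+ k.
Proof.
move=> /andP[p0 p1] a0 b0; have q0 : 0 <= 1 - p by rewrite subr_ge0.
elim: k => [|k IH]; first by rewrite !expr0 !mulr1 subrKC.
rewrite exprS; apply: le_trans (ler_wpM2l _ IH) _; first by rewrite addr_ge0// mulr_ge0.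
have h : 0 <= (a - b) * (a ^+ k - b ^+ k).
  have [ab|/ltW ba] := leP a b.
    by rewrite mulr_le0// subr_le0// lerXn2r.
  by rewrite mulr_ge0// subr_ge0// lerXn2r.
have := mulr_ge0 (mulr_ge0 p0 q0) h; rewrite !exprS; nra.
Qed.

Lemma slot_mean_split n1 n2 (h : 'I_(n1.+1 + n2.+1) -> bool -> R) :
  let p := n1.+1%:R / (n1.+1 + n2.+1)%:R in
  slot_mean h = p * slot_mean (fun v => h (lshift _ v)) +
                (1 - p) * slot_mean (fun v => h (rshift _ v)).
Proof.
rewrite /slot_mean big_split_ord /= !card_ord !natrM !natrD.
set x := \sum_i _; set y := \sum_i _.
have a0 : 0 < n1.+1%:R :> R by rewrite ltr0n.
have b0 : 0 < n2.+1%:R :> R by rewrite ltr0n.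
move: {x y} (n1.+1%:R : R) (n2.+1%:R : R) x y a0 b0 => a b x y a0 b0.
by field; rewrite !gt_eqF// addr_gt0.
Qed.

Section TwoBlocks.
Variables (K n1 n2 : nat).
Let N := (n1.+1 + n2.+1)%N.
Let p : R := n1.+1%:R / N%:R.
Let jl := @map_hedge K 'I__ 'I_N (@lshift n1.+1 n2.+1).
Let jr := @map_hedge K 'I__ 'I_N (@rshift n1.+1 n2.+1).

Lemma block_prob01 : 0 <= p <= 1.
Proof.
rewrite /p divr_ge0//= ler_pdivrMr ?mul1r ?ler_nat ?leq_addr//.
Qed.

Variables (Xi : finType) (nu : Xi -> R) (g : Xi -> 'I_N -> bool -> R).
Hypotheses (nu_ge0 : forall xi, 0 <= nu xi) (g_ge0 : forall xi v b, 0 <= g xi v b).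
Let u (e : hedge K 'I_N) : R := \sum_xi nu xi * \prod_i g xi (e.1 i) (e.2 i).

(** All three moments expand over the same [k]-tuples of replicas with the same nonnegative
    coefficients. Termwise, the slot mean over all vertices is the [p]-average of the two block slot
    means, and its [K]-th power is convex. *)
Lemma replica_convexity k :
  mean (fun e => u e ^+ k) <=
  p * mean (fun e => u (jl e) ^+ k) + (1 - p) * mean (fun e => u (jr e) ^+ k).
Proof.
have sub n (j : 'I_n -> 'I_N) : mean (fun e => u (map_hedge j e) ^+ k) =
    mean (fun e : hedge K 'I_n => (\sum_xi nu xi * \prod_i g xi (j (e.1 i)) (e.2 i)) ^+ k).
  rewrite /mean; congr (_ / _); apply: eq_bigr => e _; congr (_ ^+ _).
  by apply: eq_bigr => xi _; congr (_ * _); apply: eq_bigr => i _; rewrite ffunE.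
rewrite !sub !(@mean_power_replicas _ _ _ _ _ (fun xi v => g xi (_ v))) mean_power_replicas.
rewrite !mulr_sumr -big_split /=; apply: ler_sum => f _.
rewrite ![_ * (\prod_l nu _ * _)]mulrCA -mulrDr; apply: ler_wpM2l.
  by apply: prodr_ge0.
rewrite slot_mean_split -/p; apply: convex_power; first exact: block_prob01.
all: by rewrite /slot_mean divr_ge0// sumr_ge0// => v _; rewrite sumr_ge0// => b _;
  apply: prodr_ge0.
Qed.

Lemma mean_ln_superconvex : (forall e, u e < 1) ->
  p * mean (fun e => ln (1 - u (jl e))) + (1 - p) * mean (fun e => ln (1 - u (jr e))) <=
  mean (fun e => ln (1 - u e)).
Proof.
move=> u1.
have u01 e : 0 <= u e < 1.
  by rewrite u1 andbT sumr_ge0// => xi _; rewrite mulr_ge0// prodr_ge0.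
(* The mixture of the two block laws becomes one weighted sum over a disjoint union, the form that
   [ln_moment_compare] takes. *)
pose r (e : hedge K 'I_n1.+1 + hedge K 'I_n2.+1) :=
  match e with inl e => u (jl e) | inr e => u (jr e) end.
pose q (e : hedge K 'I_n1.+1 + hedge K 'I_n2.+1) : R :=
  match e with inl _ => p / #|hedge K 'I_n1.+1|%:R
             | inr _ => (1 - p) / #|hedge K 'I_n2.+1|%:R end.
have E (F : hedge K 'I_N -> R) :
    p * mean (fun e => F (jl e)) + (1 - p) * mean (fun e => F (jr e)) =
    \sum_e q e * F (match e with inl e => jl e | inr e => jr e end).
  by rewrite big_sumType /= /mean !(mulrC (\sum_e _)) !mulrA !mulr_sumr.
have E' (F : hedge K 'I_N -> R) : mean F = \sum_e #|hedge K 'I_N|%:R^-1 * F e.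
  by rewrite /mean mulrC mulr_sumr.
rewrite (E (fun e => ln (1 - u e))) E'.
apply: (@ln_moment_compare _ _ _ _ u _ (fun e => u (match e with inl e => jl e | inr e => jr e end))) => //.
by move=> k; rewrite -(E (fun e => u e ^+ k.+1)) -(E' (fun e => u e ^+ k.+1)) replica_convexity.
Qed.
End TwoBlocks.
End Replicas.

(** * Iterated means *)

Section Mean.
Variables (R : realType) (E : finType).
Implicit Types (f g : E -> R) (a : R).

Lemma ler_mean f g : (forall e, f e <= g e) -> mean f <= mean g.
Proof. by move=> fg; rewrite /mean ler_wpM2r ?invr_ge0// ler_sum. Qed.

Lemma meanD f g : mean (fun e => f e + g e) = mean f + mean g.
Proof. by rewrite /mean big_split mulrDl. Qed.

Lemma meanZ a f : mean (fun e => a * f e) = a * mean f.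
Proof. by rewrite /mean -mulr_sumr mulrA. Qed.

Lemma mean_cst a : (0 < #|E|)%N -> mean (fun _ : E => a) = a.
Proof.
move=> E0; rewrite /mean sumr_const -[_ *+ _]mulr_natr mulfK//.
by rewrite pnatr_eq0 -lt0n.
Qed.

Lemma mean_exchange (E' : finType) (f : E -> E' -> R) :
  mean (fun e => mean (f e)) = mean (fun e' => mean (fun e => f e e')).
Proof.
by rewrite /mean -!mulr_suml exchange_big /= mulrAC.
Qed.

End Mean.

Section IteratedMean.
Variables (R : realType) (E : finType).
Implicit Types (T : (E -> R) -> R) (F : seq E -> R) (M : nat) (s : seq E).

(** The averaging operator [T] is a parameter so that one recursion serves hyperedges uniform on all
    vertices and hyperedges uniform in a random block. The list [s] holds the hyperedges drawn so
    far. *)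
Fixpoint iter_mean T M F s : R :=
  if M is M'.+1 then T (fun e => iter_mean T M' F (e :: s)) else F s.

Definition perm_invariant F := forall s s', perm_eq s s' -> F s = F s'.

Lemma iter_mean_perm T M F : perm_invariant F -> perm_invariant (iter_mean T M F).
Proof.
move=> hF; elim: M => //= M IH s s' ss'; congr T; apply/funext => e.
by apply: IH; rewrite perm_cons.
Qed.

Lemma iter_mean_swap T M F s e e' : perm_invariant F ->
  iter_mean T M F [:: e, e' & s] = iter_mean T M F [:: e', e & s].
Proof.
move=> hF; apply: iter_mean_perm => //.
by rewrite -(cat1s e) -(cat1s e') perm_catCA.
Qed.

Definition increasing_op T := forall f g : E -> R, (forall e, f e <= g e) -> T f <= T g.

(* Replaces the hyperedges one at a time: [T2] and [T1] are the laws of an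
   old and of a new hyperedge. *)
Lemma interpolation T1 T2 F M s : perm_invariant F ->
  increasing_op T1 -> increasing_op T2 ->
  (forall f : E -> E -> R, T1 (fun e => T2 (f e)) = T2 (fun e' => T1 (fun e => f e e'))) ->
  (forall s, T2 (fun e => F (e :: s)) <= T1 (fun e => F (e :: s))) ->
  iter_mean T2 M F s <= iter_mean T1 M F s.
Proof.
move=> hF m1 m2 exch step.
(* A single replacement keeps its sign under [k] further [T2]-averages: the two operators commute
   and the order of the hyperedges is irrelevant. *)
have aux k s' : T2 (fun e => iter_mean T2 k F (e :: s')) <=
                T1 (fun e => iter_mean T2 k F (e :: s')).
  elim: k s' => [|k IH] s' /=; first exact: step.
  rewrite exch; apply: m2 => e.
  under [X in T1 X]eq_fun do rewrite iter_mean_swap//.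
  exact: IH.
elim: M s => //= M IH s; apply: le_trans (aux M s) _.
by apply: m1 => e; exact: IH.
Qed.

(** * Stability and variance under insertion of hyperedges *)

Section Lipschitz.
Variables (F : seq E -> R) (lo hi : R).
Hypotheses (E0 : (0 < #|E|)%N) (hF : perm_invariant F).
Hypothesis F_lip : forall e s, lo <= F (e :: s) - F s <= hi.
Local Notation IM := (iter_mean (@mean R E)).

Lemma iter_mean_lip M e s : lo <= IM M F (e :: s) - IM M F s <= hi.
Proof.
elim: M e s => //= M IH e s.
have -> : mean (fun e0 => IM M F [:: e0, e & s]) - mean (fun e0 => IM M F (e0 :: s)) =
    mean (fun e0 => IM M F [:: e, e0 & s] - IM M F (e0 :: s)).
  rewrite -mulN1r -meanZ -meanD; congr mean; apply/funext => e0.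
  by rewrite mulN1r iter_mean_swap.
rewrite -[X in X <= _](mean_cst lo E0).
rewrite -[X in _ && (_ <= X)](mean_cst hi E0).
by apply/andP; split; apply: ler_mean => e0; case/andP: (IH e (e0 :: s)).
Qed.

Lemma iter_mean_step M s : lo <= IM M.+1 F s - IM M F s <= hi.
Proof.
have -> : IM M.+1 F s - IM M F s = mean (fun e => IM M F (e :: s) - IM M F s).
  by rewrite meanD mean_cst.
rewrite -[X in X <= _](mean_cst lo E0) -[X in _ && (_ <= X)](mean_cst hi E0).
by apply/andP; split; apply: ler_mean => e; case/andP: (iter_mean_lip M e s).
Qed.

Lemma iter_mean_add M k s :
  k%:R * lo <= IM (M + k) F s - IM M F s <= k%:R * hi.
Proof.
elim: k => [|k IH]; first by rewrite addn0 subrr !mul0r lexx.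
have := iter_mean_step (M + k) s; move: IH; rewrite addnS -natr1.
move: (IM _ F s) (IM _.+1 F s) (IM M F s) => x y z /andP[h1 h2] /andP[h3 h4].
by apply/andP; split; lra.
Qed.
End Lipschitz.

(** Law of total variance, conditioning on the next hyperedge [e]. The induction hypothesis bounds
    the conditional variance by [M C ^ 2]; the conditional mean stays within [C] of a constant, so
    its variance is at most [C ^ 2]. *)
Lemma iter_mean_variance F (C : R) M s : (0 < #|E|)%N -> perm_invariant F ->
  (forall e s, - C <= F (e :: s) - F s <= C) ->
  iter_mean (@mean R E) M (fun s => F s ^+ 2) s - iter_mean (@mean R E) M F s ^+ 2
    <= M%:R * C ^+ 2.
Proof.
move=> E0 hF lip; elim: M s => [|M IH] s /=; first by rewrite subrr mul0r.
set X := fun e => iter_mean _ M F (e :: s).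
(* The constant is the mean without the new hyperedge. It need not be the mean of [X]: centring
   elsewhere only increases the second moment. *)
pose a := iter_mean (@mean R E) M F s.
have Xa e : (X e - a) ^+ 2 <= C ^+ 2.
  have /andP[h1 h2] := iter_mean_lip E0 hF lip M e s.
  rewrite -/a -/(X e) in h1 h2; rewrite -subr_ge0 subr_sqr mulr_ge0//; lra.
have h1 : mean (fun e => iter_mean (@mean R E) M (fun s => F s ^+ 2) (e :: s)) <=
    mean (fun e => (X e - a) ^+ 2) + 2 * a * mean X - a ^+ 2 + M%:R * C ^+ 2.
  rewrite -meanZ -meanD -[- a ^+ 2](mean_cst _ E0) -meanD.
  rewrite -[M%:R * _](mean_cst _ E0) -meanD; apply: ler_mean => e.
  by have := IH (e :: s); rewrite -/(X e); nra.
have h2 : mean (fun e => (X e - a) ^+ 2) <= C ^+ 2.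
  by rewrite -[C ^+ 2](mean_cst _ E0); apply: ler_mean.
have := sqr_ge0 (mean X - a); rewrite -natr1; nra.
Qed.

(** Identifies the recursion with the uniform law on samples. Each draw is pushed on the front of
    the list, so a sample is read in reverse, hence [catrev]. *)
Lemma iter_mean_ffun M F s :
  iter_mean (@mean R E) M F s = mean (fun g : {ffun 'I_M -> E} => F (catrev (codom g) s)).
Proof.
elim: M s => [|M IH] s /=.
  rewrite -[LHS](@mean_cst _ {ffun 'I_0 -> E}) ?card_ffun ?card_ord//.
  congr mean; apply/funext => g; congr F.
  by rewrite (size0nil (_ : size (codom g) = 0%N))// size_codom card_ord.
transitivity (mean (fun e => mean (fun g : {ffun 'I_M -> E} => F (catrev (codom g) (e :: s))))).
  by congr mean; apply/funext => e.
pose cons_ffun (p : E * {ffun 'I_M -> E}) : {ffun 'I_M.+1 -> E} :=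
  [ffun i => if unlift ord0 i is Some j then p.2 j else p.1].
have cons_bij : bijective cons_ffun.
  exists (fun g : {ffun 'I_M.+1 -> E} => (g ord0, [ffun j : 'I_M => g (lift ord0 j)])) => [[e g]|g].
    rewrite /cons_ffun ffunE unlift_none /=; congr pair.
    by apply/ffunP => j; rewrite !ffunE liftK.
  by apply/ffunP => i; rewrite ffunE; case: unliftP => [j ->|->] //=; rewrite ffunE.
rewrite /mean -mulr_suml -mulrA -invfM -natrM !card_ffun !card_ord -expnSr.
rewrite [X in _ = X / _](reindex cons_ffun) /=; last exact: onW_bij.
rewrite -(pair_bigA _ (fun (e : E) (g : {ffun 'I_M -> E}) => F (catrev (codom (cons_ffun (e, g))) s))) /=.
congr (_ / _); apply: eq_bigr => e _; apply: eq_bigr => g _; congr F.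
rewrite /codom /image_mem enum_ordSl /= -map_comp ffunE unlift_none /=.
by congr (catrev _ _); apply: eq_map => j /=; rewrite ffunE liftK.
Qed.
End IteratedMean.

(** * Partition functions and superadditivity *)

Section BinomialMean.
Variable R : realType.
Implicit Types (p q x : R) (M : nat) (f g : nat -> R).

(** The expectation of [f] at a binomial variable with parameters [M] and [p], obtained by
    conditioning on one trial. *)
Fixpoint binom_mean p M f : R :=
  if M is M'.+1 then (1 - p) * binom_mean p M' f + p * binom_mean p M' (fun k => f k.+1)
  else f 0%N.

Lemma binom_mean_lin p M a b f g :
  binom_mean p M (fun k => a * f k + b * g k) = a * binom_mean p M f + b * binom_mean p M g.
Proof. by elim: M f g => //= M IH f g; rewrite !IH; ring. Qed.

Lemma ler_binom_mean p M f g : 0 <= p <= 1 -> (forall k, f k <= g k) ->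
  binom_mean p M f <= binom_mean p M g.
Proof.
move=> /andP[p0 p1]; elim: M f g => //= M IH f g fg.
by apply: lerD; apply: ler_wpM2l; rewrite ?subr_ge0//; apply: IH.
Qed.

Lemma binom_mean_cst p M x : binom_mean p M (fun=> x) = x.
Proof. by elim: M => //= M ->; ring. Qed.

Lemma binom_mean_id p M : binom_mean p M (fun k => k%:R) = M%:R * p.
Proof.
elim: M => [|M IH] /=; first by rewrite mul0r.
rewrite (_ : (fun k => k.+1%:R) = (fun k => 1 * k%:R + 1 * (fun=> 1) k)); last first.
  by apply/funext => k; rewrite !mul1r natr1.
by rewrite binom_mean_lin binom_mean_cst IH -natr1; ring.
Qed.

(** Squared bias plus variance. The centre [x] is arbitrary because a success shifts it to [x - 1]
    in the induction. *)
Lemma binom_mean_sqr p M x :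
  binom_mean p M (fun k => (k%:R - x) ^+ 2) = (M%:R * p - x) ^+ 2 + M%:R * (p * (1 - p)).
Proof.
elim: M x => [|M IH] x /=; first by rewrite !mul0r addr0.
rewrite (_ : (fun k => (k.+1%:R - x) ^+ 2) = (fun k => (k%:R - (x - 1)) ^+ 2)); last first.
  by apply/funext => k; rewrite -natr1; congr (_ ^+ _); ring.
by rewrite !IH -natr1; ring.
Qed.

(** Thinning: keeping each success independently with probability [q] leaves a binomial variable of
    parameter [p * q]. *)
Lemma binom_mean_comp p q M f :
  binom_mean p M (fun j => binom_mean q j f) = binom_mean (p * q) M f.
Proof.
elim: M f => //= M IH f.
by rewrite binom_mean_lin !IH; ring.
Qed.
End BinomialMean.

(** * Weighted hypergraph models and their partition functions *)

Section HypergraphModel.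
Variables (R : realType) (K : nat) (chi T : finType).
Variables (nu : chi -> R) (w : {ffun 'I_K -> bool} -> {ffun 'I_K -> chi} -> R).
Implicit Types (N M : nat).

Definition edge_weight N (e : hedge K 'I_N) (x : {ffun 'I_N -> chi}) : R :=
  w e.2 [ffun j => x (e.1 j)].

Definition config_weight N (s : seq (hedge K 'I_N)) (x : {ffun 'I_N -> chi}) : R :=
  (\prod_i nu (x i)) * \prod_(e <- s) edge_weight e x.

Definition pfun N (s : seq (hedge K 'I_N)) : R := \sum_x config_weight s x.

Definition mean_lnpfun N M : R :=
  iter_mean (@mean R _) M (fun s => ln (@pfun N s)) [::].

Lemma pfun_perm N : perm_invariant (@pfun N).
Proof.
move=> s s' ss'; apply: eq_bigr => x _; congr (_ * _).
exact: perm_big.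
Qed.

Lemma lnpfun_perm N : perm_invariant (fun s => ln (@pfun N s)).
Proof. by move=> s s' /pfun_perm ->. Qed.

Lemma pfun_nil N : pfun ([::] : seq (hedge K 'I_N)) = (\sum_a nu a) ^+ N.
Proof.
rewrite -[X in _ ^+ X]card_ord -prodr_const bigA_distr_bigA /=.
by apply: eq_bigr => x _; rewrite /config_weight big_nil mulr1.
Qed.

Lemma hedge_gt0 N : (0 < #|{: hedge K 'I_N.+1}|)%N.
Proof. by rewrite card_hedge card_ord expn_gt0. Qed.

Lemma config_weight_cons N (e : hedge K 'I_N) s x :
  config_weight (e :: s) x = config_weight s x * edge_weight e x.
Proof. by rewrite /config_weight big_cons mulrCA mulrC. Qed.

Section Blocks.
Variables n1 n2 : nat.
Local Notation N := (n1 + n2)%N.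
Local Notation restl x := [ffun i => x (@lshift n1 n2 i)].
Local Notation restr x := [ffun i => x (@rshift n1 n2 i)].

(* Holds when [s] interleaves the hyperedges [s1] inside the left block and [s2] inside the
   right block. *)
Definition factors (s : seq (hedge K 'I_N)) s1 s2 := forall x : {ffun 'I_N -> chi},
  config_weight s x = config_weight s1 (restl x) * config_weight s2 (restr x).

Lemma factors_nil : factors [::] [::] [::].
Proof.
move=> x; rewrite /config_weight !big_nil !mulr1 big_split_ord /=.
by congr (_ * _); apply: eq_bigr => i _; rewrite ffunE.
Qed.

Lemma factors_consl s s1 s2 e : factors s s1 s2 ->
  factors (map_hedge (@lshift n1 n2) e :: s) (e :: s1) s2.
Proof.
move=> h x; rewrite !config_weight_cons h mulrAC; congr (_ * _ * _).
by congr w; apply/ffunP => j; rewrite !ffunE.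
Qed.

Lemma factors_consr s s1 s2 e : factors s s1 s2 ->
  factors (map_hedge (@rshift n1 n2) e :: s) s1 (e :: s2).
Proof.
move=> h x; rewrite !config_weight_cons h -mulrA; congr (_ * (_ * _)).
by congr w; apply/ffunP => j; rewrite !ffunE.
Qed.

Lemma pfun_factors s s1 s2 : factors s s1 s2 -> pfun s = pfun s1 * pfun s2.
Proof.
move=> h; rewrite /pfun mulr_suml.
under [RHS]eq_bigr do rewrite mulr_sumr.
rewrite (pair_bigA _ (fun x1 x2 => config_weight s1 x1 * config_weight s2 x2)) /=.
pose glue (p : {ffun 'I_n1 -> chi} * {ffun 'I_n2 -> chi}) : {ffun 'I_N -> chi} :=
  [ffun i : 'I_N => match fintype.split i with inl j => p.1 j | inr j => p.2 j end].
have glueK : cancel glue (fun x : {ffun 'I_N -> chi} => (restl x, restr x)).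
  move=> [x1 x2]; congr pair; apply/ffunP => i; rewrite !ffunE.
    by rewrite -[lshift _ i]/(unsplit (inl i)) unsplitK.
  by rewrite -[rshift _ i]/(unsplit (inr i)) unsplitK.
have glueK' : cancel (fun x : {ffun 'I_N -> chi} => (restl x, restr x)) glue.
  move=> x; apply/ffunP => i; rewrite ffunE /=.
  by rewrite -{2}(splitK i); case: (fintype.split i) => j /=; rewrite ffunE.
rewrite (reindex glue); last by apply: onW_bij; exists (fun x : {ffun 'I_N -> chi} => (restl x, restr x)).
apply: eq_bigr => p _; rewrite h.
by have := glueK p; case: p => x1 x2 [-> ->].
Qed.
End Blocks.

Variables (phi : T -> bool -> chi -> R) (w0 theta kmin kmax : R).
Hypotheses (nu_ge0 : forall a, 0 <= nu a) (nu_gt0 : 0 < \sum_a nu a).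
Hypotheses (w0_gt0 : 0 < w0) (theta_ge0 : 0 <= theta).
Hypotheses (w_ge0 : forall a y, 0 <= w a y) (phi_ge0 : forall t b c, 0 <= phi t b c).
Hypothesis wE : forall a y, w a y = w0 * (1 - theta * \sum_t \prod_i phi t (a i) (y i)).
Hypothesis kmin_gt0 : 0 < kmin.
Hypothesis pfun_cons : forall N (e : hedge K 'I_N) s,
  kmin * pfun s <= pfun (e :: s) <= kmax * pfun s.

Lemma pfun_gt0 N (s : seq (hedge K 'I_N)) : 0 < pfun s.
Proof.
elim: s => [|e s IH]; first by rewrite pfun_nil exprn_gt0.
by have /andP[h _] := pfun_cons e s; apply: lt_le_trans h; rewrite mulr_gt0.
Qed.

Lemma config_weight_ge0 N (s : seq (hedge K 'I_N)) x : 0 <= config_weight s x.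
Proof. by rewrite mulr_ge0 ?prodr_ge0// => e _; apply: w_ge0. Qed.

Lemma kmax_gt0 N (e : hedge K 'I_N) : 0 < kmax.
Proof.
have /andP[h1 h2] := pfun_cons e [::].
by rewrite -(pmulr_lgt0 _ (pfun_gt0 ([::] : seq (hedge K 'I_N)))) (lt_le_trans _ h2)// pfun_gt0.
Qed.

Lemma lnpfun_lip N (e : hedge K 'I_N) s :
  ln kmin <= ln (pfun (e :: s)) - ln (pfun s) <= ln kmax.
Proof.
have /andP[h1 h2] := pfun_cons e s.
have s0 := pfun_gt0 s; have es0 := pfun_gt0 (e :: s); have k0 := kmax_gt0 e.
by rewrite lerBrDr lerBlDr -!lnM ?posrE// !ler_ln ?posrE ?mulr_gt0// h1 h2.
Qed.

(** * Interpolation between one vertex set and two separate blocks *)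

Section Superadditivity.
Variables n1 n2 : nat.
Local Notation N := (n1.+1 + n2.+1)%N.
Local Notation jl := (@map_hedge K _ _ (@lshift n1.+1 n2.+1)).
Local Notation jr := (@map_hedge K _ _ (@rshift n1.+1 n2.+1)).
Let p : R := n1.+1%:R / N%:R.

Definition block_mean (f : hedge K 'I_N -> R) : R :=
  p * mean (fun e => f (jl e)) + (1 - p) * mean (fun e => f (jr e)).

Lemma block_mean_le_mean (s : seq (hedge K 'I_N)) :
  block_mean (fun e => ln (pfun (e :: s))) <= mean (fun e => ln (pfun (e :: s))).
Proof.
(* A replica is a pair of a configuration and an index [t]; its weight is [theta] times the Gibbs
   weight of the configuration. Then [u e] is the relative loss of the partition function, up to the
   factor [w0], when [e] is inserted. *)
pose nuX (xi : {ffun 'I_N -> chi} * T) := theta * (config_weight s xi.1 / pfun s).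
pose g (xi : {ffun 'I_N -> chi} * T) (v : 'I_N) (b : bool) := phi xi.2 b (xi.1 v).
pose u (e : hedge K 'I_N) := \sum_xi nuX xi * \prod_i g xi (e.1 i) (e.2 i).
have s0 := pfun_gt0 s.
have pE e : pfun (e :: s) = w0 * pfun s * (1 - u e).
  rewrite /u -(pair_bigA _ (fun x t => nuX (x, t) * \prod_i g (x, t) (e.1 i) (e.2 i))) /=.
  rewrite mulrBr mulr1 [X in _ - X]mulr_sumr.
  rewrite [X in _ = X - _](_ : _ = \sum_x w0 * config_weight s x); last exact: mulr_sumr.
  rewrite -sumrB [LHS]/pfun; apply: eq_bigr => x _.
  rewrite config_weight_cons /edge_weight wE.
  under [\sum_(t : T) (\prod_i phi t _ _)]eq_bigr do under eq_bigr do rewrite ffunE.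
  rewrite /nuX /g /= -mulr_sumr; field; rewrite ?gt_eqF//.
(* This follows from positivity of the enlarged partition function, and so also holds when some edge
   weights vanish. *)
have u1 e : u e < 1.
  have := pfun_gt0 (e :: s); rewrite pE pmulr_rgt0 ?mulr_gt0//.
  by rewrite subr_gt0.
have lnE : (fun e => ln (pfun (e :: s))) = (fun e => ln (w0 * pfun s) + ln (1 - u e)).
  apply/funext => e; rewrite pE lnM ?posrE ?mulr_gt0//.
  by rewrite subr_gt0.
rewrite lnE /block_mean !meanD !mean_cst ?hedge_gt0//.
rewrite (_ : p * _ + _ = ln (w0 * pfun s) + (p * mean (fun e => ln (1 - u (jl e))) +
   (1 - p) * mean (fun e => ln (1 - u (jr e))))); last by ring.
rewrite lerD2l; apply: (@mean_ln_superconvex R K n1 n2 _ nuX g _ _ u1).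
  by move=> xi; rewrite mulr_ge0// divr_ge0 ?config_weight_ge0// ltW.
by move=> xi v b; apply: phi_ge0.
Qed.

Lemma block_mean_exchange (f : hedge K 'I_N -> hedge K 'I_N -> R) :
  mean (fun e => block_mean (f e)) = block_mean (fun e' => mean (fun e => f e e')).
Proof. by rewrite /block_mean meanD !meanZ !(@mean_exchange _ (hedge K 'I_N)). Qed.

(** Each hyperedge falls in the left block with probability [p]. The logarithm of the product is a
    sum, so only the marginal laws of the two edge counts enter, not their joint law. *)
Lemma iter_block_mean M (s : seq (hedge K 'I_N)) s1 s2 : factors s s1 s2 ->
  iter_mean block_mean M (fun s => ln (pfun s)) s =
  binom_mean p M (fun k => iter_mean (@mean R _) k (fun s => ln (pfun s)) s1) +
  binom_mean (1 - p) M (fun k => iter_mean (@mean R _) k (fun s => ln (pfun s)) s2).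
Proof.
have bm q k n (G : hedge K 'I_n -> nat -> R) :
    binom_mean q k (fun j => mean (G^~ j)) = mean (fun e => binom_mean q k (G e)).
  elim: k G => //= k IH G.
  by rewrite meanD !meanZ IH (IH (fun e j => G e j.+1)).
elim: M s s1 s2 => [|M IH] s s1 s2 h /=.
  by rewrite (pfun_factors h) lnM ?posrE ?pfun_gt0.
rewrite /block_mean.
under [X in p * mean X]eq_fun do rewrite (IH _ _ _ (factors_consl _ h)).
under [X in (1 - p) * mean X]eq_fun do rewrite (IH _ _ _ (factors_consr _ h)).
rewrite !meanD !mean_cst ?hedge_gt0// -!bm; ring.
Qed.

Lemma mean_lnpfun_superadditive M :
  binom_mean p M (mean_lnpfun n1.+1) + binom_mean (1 - p) M (mean_lnpfun n2.+1) <=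
  mean_lnpfun N M.
Proof.
rewrite /mean_lnpfun -(iter_block_mean M (@factors_nil _ _)).
have /andP[p0 p1] := @block_prob01 R n1 n2.
apply: interpolation; first exact: lnpfun_perm.
- exact: ler_mean.
- by move=> f g fg; apply: lerD; apply: ler_wpM2l; rewrite ?subr_ge0//; apply: ler_mean.
- exact: block_mean_exchange.
- exact: block_mean_le_mean.
Qed.
End Superadditivity.
End HypergraphModel.

(** * Existence of the scaling limit *)

(** The limit is the supremum of the eventual lower bounds: the sequence ends up above anything
    smaller, and for large [n] the number [x n - e] is itself such a bound. *)
Lemma cvg_of_eventual_lower_bounds (R : realType) (x : nat -> R) (B : R) :
  (forall n, x n <= B) ->
  (forall e, 0 < e -> exists n0, forall n, (n0 <= n)%N ->
     exists N0, forall N, (N0 <= N)%N -> x n - e <= x N) ->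
  exists l : R, x @ \oo --> l.
Proof.
move=> xB H.
pose A := [set y : R | exists N0, forall N, (N0 <= N)%N -> y <= x N].
have A0 : A !=set0.
  by have [n0 h] := H 1 ltr01; exists (x n0 - 1); have := h n0 (leqnn _).
have AB : ubound A B by move=> y [N0 /(_ _ (leqnn _)) h]; apply: le_trans h (xB _).
have Asup : has_sup A by split=> //; exists B.
exists (sup A); apply/cvgrPdist_le => e e0.
have [y [N1 hy] ye] := sup_adherent e0 Asup.
have [n0 hn] := H e e0.
exists (maxn N1 n0) => // n /=; rewrite geq_max => /andP[n1 n2].
have h1 := hy n n1.
have h2 : x n - e <= sup A by apply: sup_upper_bound => //; exact: hn.
by rewrite ler_norml; apply/andP; split; lra.
Qed.

Section ScalingLimit.
Variables (R : realType) (a : nat -> nat -> R) (b lo hi : R).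
Hypothesis a_superadditive : forall n1 n2 M,
  let p := n1.+1%:R / (n1.+1 + n2.+1)%:R in
  binom_mean p M (a n1.+1) + binom_mean (1 - p) M (a n2.+1) <= a (n1.+1 + n2.+1)%N M.
Hypothesis a_lip : forall N M k, k%:R * lo <= a N.+1 (M + k)%N - a N.+1 M <= k%:R * hi.
Hypothesis a0 : forall N, a N 0 = N%:R * b.
Let C : R := Num.max `|lo| `|hi|.

Lemma lip_const_ge0 : 0 <= C. Proof. by rewrite le_max normr_ge0. Qed.

Lemma lip_dist N M M' : `|a N.+1 M - a N.+1 M'| <= C * `|M%:R - M'%:R|.
Proof.
wlog h : M M' / (M' <= M)%N => [W|].
  have [/W//|/ltnW/W] := leqP M' M.
  by rewrite distrC [X in _ -> _ <= _ * X]distrC.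
rewrite -(subnKC h) natrD (addrC M'%:R) addrK [X in C * X]ger0_norm//.
have := a_lip N M' (M - M'); set k : R := (M - M')%:R => /andP[h1 h2].
have k0 : 0 <= k by [].
have l1 : - C <= lo by rewrite lerNl (le_trans (ler_norm (- lo)))// normrN le_max lexx.
have l2 : hi <= C by rewrite (le_trans (ler_norm hi))// le_max lexx orbT.
rewrite ler_norml; apply/andP; split.
  apply: le_trans h1; rewrite -mulNr mulrC; exact: ler_wpM2l.
by apply: le_trans h2 _; rewrite mulrC; exact: ler_wpM2r.
Qed.

Lemma binom_mean1 M (f : nat -> R) : binom_mean 1 M f = f M.
Proof. by elim: M f => //= M IH f; rewrite !IH subrr mul0r mul1r add0r. Qed.

(** Blocks of size [n.+1] are split off one at a time; thinning collapses the nested binomials into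
    a single one. The last block has size [r.+1] because superadditivity is stated for nonempty
    blocks. *)
Lemma many_blocks_lower_bound k n r M :
  let N := (k * n.+1 + r.+1)%N in
  k%:R * binom_mean (n.+1%:R / N%:R) M (a n.+1) + binom_mean (r.+1%:R / N%:R) M (a r.+1)
    <= a N M.
Proof.
elim: k M => [|k IH] M /=.
  by rewrite mul0r add0r mul0n add0n divff ?pnatr_eq0// binom_mean1.
have mE : (k * n.+1 + r.+1 = (k * n.+1 + r).+1)%N by rewrite addnS.
rewrite mulSn -addnA mE; rewrite /= mE in IH.
set m := (k * n.+1 + r)%N in IH *.
apply: le_trans (a_superadditive n m M).
have n0 : 0 < n.+1%:R :> R by rewrite ltr0n.
have m0 : 0 < m.+1%:R :> R by rewrite ltr0n.
set p := n.+1%:R / _.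
have p01 : 0 <= p <= 1 by exact: block_prob01.
have /andP[q0 q1] : 0 <= 1 - p <= 1 by case/andP: p01 => *; rewrite subr_ge0 lerBlDr lerDl; apply/andP.
have comp : forall x : R, x / (n.+1 + m.+1)%:R = (1 - p) * (x / m.+1%:R).
  move=> x; rewrite /p natrD; move: (n.+1%:R : R) (m.+1%:R : R) n0 m0 => u v u0 v0.
  by field; rewrite !gt_eqF// addr_gt0.
have := @ler_binom_mean R (1 - p) M _ _ _ IH.
rewrite q0 q1 => /(_ isT).
rewrite (_ : (fun j => k%:R * _ + _) = (fun j => k%:R * binom_mean (n.+1%:R / m.+1%:R) j (a n.+1) +
   1 * binom_mean (r.+1%:R / m.+1%:R) j (a r.+1))); last by apply/funext => j; rewrite mul1r.
rewrite binom_mean_lin !binom_mean_comp -!comp -/p mul1r => h.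
by rewrite -(natr1 k) mulrDl mul1r; lra.
Qed.

(** The number of hyperedges in a block of size [n.+1] is binomial, with mean within 1 of
    [nedges c n.+1] and variance at most [c * n.+1]. The amount subtracted in [y] pays for this
    fluctuation, and the term not multiplied by [N] pays for the last block. *)
Lemma scaled_lower_bound (c e : R) n k r : 0 < c -> 0 < e -> (r <= n)%N ->
  let N := (k * n.+1 + r.+1)%N in
  let y := a n.+1 (nedges c n.+1) / n.+1%:R - C * (e + (1 + c * n.+1%:R) / (e * n.+1%:R ^+ 2)) in
  N%:R * y - n.+1%:R * (`|y| + `|b| + C * c) <= a N (nedges c N).
Proof.
move=> c0 e0 rn; rewrite /=; set N := (_ + _)%N; set y := _ / _ - _; apply: le_trans (many_blocks_lower_bound k n r _); rewrite -/N.
set M := nedges c N; set m := nedges c n.+1.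
have C0 := lip_const_ge0.
have nd j : (nedges c j)%:R <= c * j%:R < (nedges c j)%:R + 1.
  by have := @truncn_itv _ (c * j%:R) (mulr_ge0 (ltW c0) (ler0n _ _)); rewrite natr1.
have N0 : 0 < N%:R :> R by rewrite ltr0n /N addnS.
have v0 : 0 < n.+1%:R :> R by rewrite ltr0n.
have rv : r.+1%:R <= n.+1%:R :> R by rewrite ler_nat.
have r0 : 0 < r.+1%:R :> R by rewrite ltr0n.
have NE : N%:R = k%:R * n.+1%:R + r.+1%:R :> R by rewrite natrD natrM.
have k0 : 0 <= k%:R :> R by [].
have vN : n.+1%:R / N%:R * N%:R = n.+1%:R :> R by rewrite divfK// gt_eqF.
have rN : r.+1%:R / N%:R * N%:R = r.+1%:R :> R by rewrite divfK// gt_eqF.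
have /andP[M1 M2] := nd N; have /andP[m1 m2] := nd n.+1.
rewrite -/M in M1 M2; rewrite -/m in m1 m2.
have r01 : 0 <= (r.+1%:R / N%:R : R) <= 1.
  by rewrite divr_ge0//= ler_pdivrMr// mul1r ler_nat leq_addl.
set q := r.+1%:R / N%:R in rN r01 *; set p := n.+1%:R / N%:R in vN *.
have p0 : 0 <= p by rewrite /p divr_ge0.
(* The last block is compared with its edgeless version, at cost [C] per hyperedge; its mean number
   of hyperedges is at most [c * r.+1]. *)
have Hr : - (n.+1%:R * `|b|) - C * (c * n.+1%:R) <= binom_mean q M (a r.+1).
  have h : forall j, (r.+1%:R * b) * 1 + (- C) * j%:R <= a r.+1 j.
    move=> j; have := lip_dist r j 0; rewrite a0 subr0 (ger0_norm (ler0n _ j)).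
    by rewrite ler_norml => /andP[h _]; lra.
  have {h} := ler_binom_mean M r01 h.
  rewrite binom_mean_lin binom_mean_cst binom_mean_id mulr1 => h.
  apply: le_trans h.
  have : r.+1%:R * - b <= n.+1%:R * `|b|.
    apply: le_trans (ler_wpM2l (ltW r0) (ler_norm _)) _.
    by rewrite normrN ler_wpM2r.
  have : C * (M%:R * q) <= C * (c * n.+1%:R).
    apply: ler_wpM2l => //; apply: le_trans (ler_wpM2l (ltW c0) rv).
    have /andP[q0 _] := r01.
    by have := ler_wpM2r q0 M1; rewrite /= -mulrA (mulrC N%:R) rN.
  by rewrite mulrN; lra.
have Hn : k%:R * (n.+1%:R * y) <= k%:R * binom_mean p M (a n.+1).
  have [->|k1] := posnP k; first by rewrite !mul0r.
  apply: ler_wpM2l => //.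
  have p1 : p <= 1.
    rewrite /p ler_pdivrMr// mul1r ler_nat /N (leq_trans _ (leq_addr _ _))//.
    by rewrite leq_pmull.
  (* Since only the second moment of the binomial is known, the absolute deviation [d] is bounded by
     [h + d ^ 2 / h], at the scale [h] proportional to the block size. *)
  pose h := e * n.+1%:R.
  have h0 : 0 < h by rewrite mulr_gt0.
  have H j : (a n.+1 m - C * h) * 1 + (- (C / h)) * (j%:R - m%:R) ^+ 2 <= a n.+1 j.
    have := lip_dist n j m; rewrite ler_norml => /andP[d1 _].
    have : `|j%:R - m%:R| <= h + (j%:R - m%:R) ^+ 2 / h.
      rewrite -(ler_pM2r h0) mulrDl divfK ?gt_eqF// -(@real_normK _ (j%:R - m%:R)) ?num_real//.
      by have := normr_ge0 (j%:R - m%:R : R); nra.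
    move/(ler_wpM2l C0); rewrite mulrDr => d2.
    by rewrite mulr1 mulNr -mulrA [h^-1 * _]mulrC; lra.
  have p01 : 0 <= p <= 1 by rewrite p0.
  have {H} := ler_binom_mean M p01 H.
  rewrite binom_mean_lin binom_mean_cst binom_mean_sqr mulr1; apply: le_trans.
  have E : n.+1%:R * y = a n.+1 m - C * h - C / h * (1 + c * n.+1%:R).
    rewrite /y /h -/m; move: (n.+1%:R : R) v0 => v v0; field.
    by rewrite !gt_eqF.
  rewrite E mulNr lerD2l lerN2; apply: ler_wpM2l; first by rewrite divr_ge0// ltW.
  have Mp : M%:R * p <= c * n.+1%:R.
    by have := ler_wpM2r p0 M1; rewrite /= -mulrA (mulrC N%:R) vN.
  have Mp' : c * n.+1%:R - 1 <= M%:R * p.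
    rewrite -[in leLHS]vN; nra.
  apply: lerD.
    by nra.
  have M0 : 0 <= M%:R :> R by [].
  have Mp0 := mulr_ge0 M0 p0; nra.
apply: le_trans (lerD Hn Hr).
rewrite NE.
have : - (r.+1%:R * y) >= - (n.+1%:R * `|y|).
  rewrite lerN2; apply: le_trans (ler_wpM2l (ltW r0) (ler_norm _)) _.
  by rewrite ler_wpM2r.
by move=> ?; nra.
Qed.

Lemma nedges_bounds (c : R) N : 0 <= c ->
  (nedges c N)%:R <= c * N%:R /\ c * N%:R <= (nedges c N)%:R + 1.
Proof.
move=> c0; have := @truncn_itv _ (c * N%:R) (mulr_ge0 c0 (ler0n _ _)).
by rewrite natr1 => /andP[? /ltW].
Qed.

Lemma cvg_scaled_mean (c : R) : 0 < c ->
  exists l : R, (fun N => a N (nedges c N) / N%:R) @ \oo --> l.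
Proof.
move=> c0; have C0 := lip_const_ge0.
apply: (@cvg_of_eventual_lower_bounds _ _ (`|b| + C * c)) => [[|n]|e e0].
(* At [N = 0] the quotient is 0 by the convention on inverses. *)
- by rewrite invr0 mulr0 addr_ge0// mulr_ge0// ltW.
- have n0 : 0 < n.+1%:R :> R by rewrite ltr0n.
  rewrite ler_pdivrMr//; have := lip_dist n (nedges c n.+1) 0.
  rewrite a0 subr0 (ger0_norm (ler0n _ (nedges c _))) ler_norml => /andP[_ h].
  have [h1 _] := nedges_bounds n.+1 (ltW c0).
  have := ler_wpM2l C0 h1; have := ler_wpM2r (ltW n0) (ler_norm b).
  by rewrite /= mulrDl; lra.
(* Two errors [C * d] come from the fluctuation term of [y] and one error [d] from the last
   block. *)
pose d := e / (2 * C + 2).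
have K0 : 0 < 2 * C + 2 by lra.
have d0 : 0 < d by rewrite divr_gt0.
have de : C * (d + d) + d <= e.
  by rewrite -(divfK (lt0r_neq0 K0) e) -/d; nra.
clearbody d.
(* From this size on, [(1 + c * n) / (d * n ^ 2)] is at most [d]. *)
exists (Num.truncn ((1 + c) / d ^+ 2)).+1 => -[//|n] hn.
set y := a n.+1 (nedges c n.+1) / n.+1%:R - C * (d + (1 + c * n.+1%:R) / (d * n.+1%:R ^+ 2)).
have v0 : 0 < n.+1%:R :> R by rewrite ltr0n.
have v1 : 1 <= n.+1%:R :> R by rewrite ler1n.
have xy : a n.+1 (nedges c n.+1) / n.+1%:R - C * (d + d) <= y.
  rewrite lerD2l lerN2; apply: ler_wpM2l => //; rewrite lerD2l.
  rewrite ler_pdivrMr ?mulr_gt0 ?exprn_gt0//.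
  have : (1 + c) / d ^+ 2 <= n.+1%:R.
    by apply/ltW/(lt_le_trans (truncnS_gt _)); rewrite ler_nat.
  rewrite ler_pdivrMr ?exprn_gt0// => h.
  have := ler_wpM2r (ltW v0) h; nra.
set D := `|y| + `|b| + C * c.
have D0 : 0 <= D by rewrite !addr_ge0// mulr_ge0// ltW.
(* From this size on, the bounded cost [n.+1 * D] of the last block is at most [d * N]. *)
exists (Num.truncn (n.+1%:R * D / d)).+1 => -[//|N] hN.
have N0 : 0 < N.+1%:R :> R by rewrite ltr0n.
have NE : (N %/ n.+1 * n.+1 + (N %% n.+1).+1 = N.+1)%N by rewrite addnS -divn_eq.
have := @scaled_lower_bound c d n (N %/ n.+1) (N %% n.+1) c0 d0.
rewrite -ltnS ltn_mod NE => /(_ isT); rewrite /= -/y -/D => h.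
rewrite ler_pdivlMr//; apply: le_trans h.
have : n.+1%:R * D / d <= N.+1%:R.
  by apply/ltW/(lt_le_trans (truncnS_gt _)); rewrite ler_nat.
rewrite ler_pdivrMr// => h.
clearbody D y; move: (a n.+1 _ / _) (C * (d + d)) xy de => X t xy de.
have {}xy : X - e <= y - d by lra.
by have := ler_wpM2r (ltW N0) xy; rewrite /= [leRHS]mulrBl; lra.
Qed.

Lemma cvg_nedges (c : R) : 0 < c -> (fun N => (nedges c N)%:R / N%:R) @ \oo --> c.
Proof.
move=> c0; apply/cvgrPdist_le => e e0.
exists (Num.truncn e^-1).+1 => // -[//|N] /= hN.
have N0 : 0 < N.+1%:R :> R by rewrite ltr0n.
have : e^-1 <= N.+1%:R by apply/ltW/(lt_le_trans (truncnS_gt _)); rewrite ler_nat.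
rewrite -[e^-1]mul1r ler_pdivrMr// => h.
have [h1 h2] := nedges_bounds N.+1 (ltW c0).
rewrite -[X in `|X - _|](mulfK (lt0r_neq0 N0)) -mulrBl normrM.
by rewrite [`|_^-1|]gtr0_norm ?invr_gt0// ler_pdivrMr// ler_norml; apply/andP; split; lra.
Qed.

Lemma scaled_mean_lip (c1 c2 z1 z2 : R) : 0 < c1 -> c1 <= c2 ->
  (fun N => a N (nedges c1 N) / N%:R) @ \oo --> z1 ->
  (fun N => a N (nedges c2 N) / N%:R) @ \oo --> z2 ->
  lo * (c2 - c1) <= z2 - z1 <= hi * (c2 - c1).
Proof.
move=> c10 c12 h1 h2.
have c20 := lt_le_trans c10 c12.
have hd : (fun N => a N (nedges c2 N) / N%:R - a N (nedges c1 N) / N%:R) @ \oo --> z2 - z1.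
  exact: cvgB.
have hs x : (fun N => x * ((nedges c2 N)%:R / N%:R - (nedges c1 N)%:R / N%:R)) @ \oo -->
    x * (c2 - c1).
  by apply: cvgMl_tmp; apply: cvgB; exact: cvg_nedges.
have key N : (0 < N)%N -> let d := (nedges c2 N)%:R / N%:R - (nedges c1 N)%:R / N%:R in
    lo * d <= a N (nedges c2 N) / N%:R - a N (nedges c1 N) / N%:R <= hi * d.
  case: N => // N _; rewrite /= -!mulrBl.
  have le12 : (nedges c1 N.+1 <= nedges c2 N.+1)%N.
    by apply: le_truncn; apply: ler_wpM2r.
  have := a_lip N (nedges c1 N.+1) (nedges c2 N.+1 - nedges c1 N.+1).
  rewrite subnKC// natrB// => /andP[k1 k2].
  by rewrite !mulrA !ler_wpM2r ?invr_ge0// mulrC ?k1// mulrC.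
apply/andP; split.
- apply: (ler_cvg_to (hs lo) hd).
  by exists 1%N => // N /key /andP[].
- apply: (ler_cvg_to hd (hs hi)).
  by exists 1%N => // N /key /andP[].
Qed.
End ScalingLimit.

(** * Concentration *)

(* For a fixed [t] the defect [1 - w / w0] is a product over the slots of the hyperedge: this is
   what makes its moments averages of [K]-th powers. *)
Definition replica_form (R : realType) (K : nat) (chi : finType)
    (w : {ffun 'I_K -> bool} -> {ffun 'I_K -> chi} -> R) :=
  exists (T : finType) (phi : T -> bool -> chi -> R) (w0 theta : R),
    [/\ 0 < w0, 0 <= theta, forall t b c, 0 <= phi t b c &
      forall a y, w a y = w0 * (1 - theta * \sum_t \prod_i phi t (a i) (y i))].

(** The bounds concern the ratio of partition functions rather than [w] itself, so that a positive
    [kmin] is possible for independent sets, where [w] takes the value 0. *)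
Definition insertion_bounds (R : realType) (K : nat) (chi : finType) (nu : chi -> R)
    (w : {ffun 'I_K -> bool} -> {ffun 'I_K -> chi} -> R) (kmin kmax : R) :=
  forall N (e : hedge K 'I_N) s,
    kmin * pfun nu w s <= pfun nu w (e :: s) <= kmax * pfun nu w s.

Lemma chebyshev_mean (R : realType) (E : finType) (f : E -> R) (A t : R) : 0 < t ->
  #|[set g | t < `|f g - A|]%SET|%:R / #|E|%:R <= mean (fun g => (f g - A) ^+ 2) / t ^+ 2.
Proof.
move=> t0; rewrite ler_pdivlMr ?exprn_gt0// mulrAC; apply: ler_wpM2r; first by rewrite invr_ge0.
rewrite -sum1_card natr_sum mulr_suml [leRHS](bigID (fun g => g \in [set g | t < `|f g - A|]%SET)) /=.
rewrite -[leLHS]addr0; apply: lerD; last by apply: sumr_ge0 => g _; exact: sqr_ge0.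
apply: ler_sum => g; rewrite inE mul1r -(@real_normK _ (f g - A)) ?num_real// => /ltW h.
by rewrite lerXn2r// nnegrE ltW.
Qed.

Section ModelWeights.
Variables (R : realType) (lambda : R) (m : model R).
Hypothesis lambda_gt0 : 0 < lambda.

Definition node_weight (c : 'I_(mq m)) : R := lambda `^ node_pot c.

Definition edge_factor (a : {ffun 'I_(mK m) -> bool}) (y : {ffun 'I_(mK m) -> 'I_(mq m)}) : R :=
  if edge_pot a y is Some h then lambda `^ h else 0.

Lemma powR_sum (I : finType) (f : I -> R) : lambda `^ (\sum_i f i) = \prod_i lambda `^ f i.
Proof.
apply: (big_morph (fun h => lambda `^ h)); last exact: powRr0.
by move=> x y; rewrite powRD//; apply/implyP => _; rewrite gt_eqF.
Qed.

Lemma Zpart_pfun N M (g : sample m N M) :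
  Zpart lambda g = pfun node_weight edge_factor (catrev (codom g) [::]).
Proof.
rewrite (_ : pfun _ _ _ = pfun node_weight edge_factor (codom g)); last first.
  by apply: pfun_perm; rewrite -[catrev _ _]/(rev (codom g)) perm_rev.
apply: eq_bigr => x _; rewrite /config_weight big_map big_enum /= /hamiltonian.
case: ifPn => [/existsP[e /eqP he]|].
  by rewrite (bigD1 e) //= /edge_weight /edge_factor he mul0r mulr0.
rewrite negb_exists => /forallP h.
rewrite powRD; last by apply/implyP => _; rewrite gt_eqF.
rewrite !powR_sum; congr (_ * _); apply: eq_bigr => e _.
by have := h e; rewrite /edge_weight /edge_factor; case: edge_pot.
Qed.

Variables kmin kmax : R.
Hypotheses (mq_gt0 : (0 < mq m)%N) (kmin_gt0 : 0 < kmin).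
Hypothesis hreplica : replica_form edge_factor.
Hypothesis hinsert : insertion_bounds node_weight edge_factor kmin kmax.

Lemma edge_factor_ge0 a y : 0 <= edge_factor a y.
Proof. by rewrite /edge_factor; case: edge_pot => // h; exact: powR_ge0. Qed.

Lemma sum_node_weight_gt0 : 0 < \sum_c node_weight c.
Proof.
rewrite (bigD1 (Ordinal mq_gt0)) //= ltr_wpDr ?powR_gt0// sumr_ge0// => c _.
exact: powR_ge0.
Qed.

Let a := mean_lnpfun node_weight edge_factor.
Let C : R := Num.max `|ln kmin| `|ln kmax|.

Lemma lnpfun_insertion N (e : hedge (mK m) 'I_N) s :
  ln kmin <= ln (pfun node_weight edge_factor (e :: s)) - ln (pfun node_weight edge_factor s)
    <= ln kmax.
Proof.
exact: (lnpfun_lip sum_node_weight_gt0 kmin_gt0 hinsert).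
Qed.

(** Chebyshev's inequality on the sample space, where [iter_mean_ffun] turns the variance bound for
    iterated means into one for [ln Z]. *)
Lemma lnZ_concentration N M (t : R) : 0 < t ->
  uprob (fun g : sample m N.+1 M => t < `|ln (Zpart lambda g) - a N.+1 M|)
    <= M%:R * C ^+ 2 / t ^+ 2.
Proof.
move=> t0; pose F s := ln (@pfun _ _ _ node_weight edge_factor N.+1 s).
have E0 := hedge_gt0 (mK m) N.
have hF : perm_invariant F by exact: lnpfun_perm.
have lip e s : - C <= F (e :: s) - F s <= C.
  have /andP[h1 h2] := lnpfun_insertion e s; apply/andP; split.
    by apply: le_trans h1; rewrite lerNl (le_trans (ler_norm _))// normrN le_max lexx.
  by apply: le_trans h2 _; rewrite (le_trans (ler_norm _))// le_max lexx orbT.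
have var := iter_mean_variance M [::] E0 hF lip.
rewrite /uprob; under eq_finset do rewrite Zpart_pfun.
apply: le_trans (chebyshev_mean (fun g : sample m N.+1 M => F (catrev (codom g) [::])) _ t0) _.
apply: ler_wpM2r; first by rewrite invr_ge0 exprn_ge0// ltW.
apply: le_trans var; rewrite !iter_mean_ffun.
have S0 : (0 < #|{: sample m N.+1 M}|)%N by rewrite card_ffun expn_gt0 (E0 : (0 < #|_|)%N).
pose f (g : sample m N.+1 M) := F (catrev (codom g) [::]).
have -> : a N.+1 M = mean f by exact: iter_mean_ffun.
have -> : (fun g : sample m N.+1 M => (F (catrev (codom g) [::]) - mean f) ^+ 2) =
    (fun g => f g ^+ 2 + ((- 2 * mean f) * f g + mean f ^+ 2)).
  by apply/funext => g; rewrite -/(f g); ring.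
by rewrite !meanD meanZ mean_cst// /f; lra.
Qed.

(** The two-sided slope bound serves twice: it gives the Lipschitz property, and monotonicity once
    [kmin] or [kmax] is compared with 1. *)
Theorem model_scaling_limit : exists z : R -> R,
  (forall c : R, 0 < c -> forall eps : R, 0 < eps ->
     (fun N : nat => uprob (fun g : sample m N (nedges c N) =>
        eps < `| ln (Zpart lambda g) / N%:R - z c |)) @ \oo --> 0) /\
  (forall c1 c2 : R, 0 < c1 -> c1 <= c2 ->
     ln kmin * (c2 - c1) <= z c2 - z c1 <= ln kmax * (c2 - c1)).
Proof.
have a_sup n1 n2 M : let p : R := n1.+1%:R / (n1.+1 + n2.+1)%:R in
    binom_mean p M (a n1.+1) + binom_mean (1 - p) M (a n2.+1) <= a (n1.+1 + n2.+1)%N M.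
  have [T [phi [w0 [theta [w00 th0 phi0 wE]]]]] := hreplica.
  have nu0 c : 0 <= node_weight c by exact: powR_ge0.
  exact: (mean_lnpfun_superadditive nu0 sum_node_weight_gt0 w00 th0 edge_factor_ge0 phi0 wE
    kmin_gt0 hinsert).
have a_lip N M k : k%:R * ln kmin <= a N.+1 (M + k)%N - a N.+1 M <= k%:R * ln kmax.
  apply: iter_mean_add; first exact: hedge_gt0.
    exact: lnpfun_perm.
  exact: lnpfun_insertion.
have a0 N : a N 0 = N%:R * ln (\sum_c node_weight c).
  by rewrite /a /mean_lnpfun /= pfun_nil lnXn ?sum_node_weight_gt0// mulr_natl.
have cv (c : R) : 0 < c -> exists l : R, (fun N => a N (nedges c N) / N%:R) @ \oo --> l.
  exact: (cvg_scaled_mean a_sup a_lip a0).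
pose z (c : R) := lim ((fun N => a N (nedges c N) / N%:R) @ \oo).
have zP (c : R) : 0 < c -> (fun N => a N (nedges c N) / N%:R) @ \oo --> z c.
  by move=> /cv[l hl]; rewrite /z (cvg_lim _ hl).
exists z; split; last first.
  move=> c1 c2 c10 c12; apply: (scaled_mean_lip a_lip) => //; apply: zP => //.
  exact: lt_le_trans c12.
move=> c c0 eps eps0; apply/cvgrPdist_le => d d0.
have /cvgrPdist_le/(_ _ (divr_gt0 eps0 (ltr0n _ 2))) [N1 _ hN1] := zP c c0.
(* Chebyshev's bound at deviation [eps / 2 * N] with at most [c * N] hyperedges is at most
   [Q * d / N], hence at most [d] once [N] reaches [Q]. The other half of [eps] covers the distance
   from the scaled mean to [z c]. *)
pose Q := c * C ^+ 2 / (eps / 2) ^+ 2 / d.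
exists (maxn N1 (Num.truncn Q).+1) => // -[|N] /=; first by rewrite geq_max ltn0 andbF.
rewrite geq_max => /andP[/hN1 /= hz hN].
have N0 : 0 < N.+1%:R :> R by rewrite ltr0n.
have QN : Q <= N.+1%:R by apply/ltW/(lt_le_trans (truncnS_gt _)); rewrite ler_nat.
rewrite sub0r normrN ger0_norm; last by rewrite divr_ge0.
have t0 : 0 < eps / 2 * N.+1%:R by rewrite mulr_gt0// divr_gt0.
have h := lnZ_concentration N (nedges c N.+1) t0.
apply: (@le_trans _ _ (uprob (fun g : sample m N.+1 (nedges c N.+1) =>
    eps / 2 * N.+1%:R < `|ln (Zpart lambda g) - a N.+1 (nedges c N.+1)|))).
  rewrite /uprob ler_wpM2r ?invr_ge0// ler_nat; apply: subset_leq_card.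
  apply/fintype.subsetP => g; rewrite !inE => hg.
  rewrite -ltr_pdivlMr//.
  rewrite -[X in _ < _ / X](gtr0_norm N0) -normf_div mulrBl.
  move: hz hg; set x := _ / _; set y := ln _ / _ => hz hg.
  by have := ler_distD x y (z c); rewrite (distrC x); lra.
apply: le_trans h _.
have [h1 _] := nedges_bounds N.+1 (ltW c0).
rewrite ler_pdivrMr ?exprn_gt0// exprMn.
apply: le_trans (ler_wpM2r (sqr_ge0 C) h1) _.
move: QN; rewrite /Q ler_pdivrMr// ler_pdivrMr ?exprn_gt0 ?divr_gt0// => QN.
by have := ler_wpM2r (ltW N0) QN; rewrite /=; lra.
Qed.
End ModelWeights.

(** * The six models *)

Lemma insertion_bounds_pointwise (R : realType) (K : nat) (chi : finType) (nu : chi -> R)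
    (w : {ffun 'I_K -> bool} -> {ffun 'I_K -> chi} -> R) (kmin kmax : R) :
  (forall c, 0 <= nu c) -> 0 <= kmin -> (forall a y, kmin <= w a y <= kmax) ->
  insertion_bounds nu w kmin kmax.
Proof.
move=> nu0 k0 wb N e s.
have w0 a y : 0 <= w a y by case/andP: (wb a y) => h _; exact: le_trans h.
rewrite /pfun !mulr_sumr; apply/andP; split; apply: ler_sum => x _;
  rewrite config_weight_cons [_ * config_weight _ _ _ _]mulrC;
  by apply: ler_wpM2l; rewrite ?config_weight_ge0// /edge_weight; case/andP: (wb e.2 [ffun j => x (e.1 j)]).
Qed.

(** With [w0 = whi] and [theta = 1 - wlo / whi], the defect is [theta] times the indicator of the
    penalised event [P]. It remains to write that indicator as a sum of products over slots. *)
Lemma replica_form_two_valued (R : realType) (K : nat) (chi T : finType)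
    (w : {ffun 'I_K -> bool} -> {ffun 'I_K -> chi} -> R) (P : {ffun 'I_K -> bool} -> {ffun 'I_K -> chi} -> bool)
    (phi : T -> bool -> chi -> bool) (wlo whi : R) :
  wlo <= whi -> 0 < whi -> (forall a y, w a y = if P a y then wlo else whi) ->
  (forall (a : {ffun 'I_K -> bool}) (y : {ffun 'I_K -> chi}),
     \sum_t \prod_i (phi t (a i) (y i))%:R = (P a y)%:R :> R) ->
  replica_form w.
Proof.
move=> le hi0 wE PE; exists T, (fun t b c => (phi t b c)%:R), whi, (1 - wlo / whi); split => //.
  by rewrite subr_ge0 ler_pdivrMr// mul1r.
move=> a y; rewrite PE wE; case: (P a y); last by rewrite mulr0 subr0 mulr1.
by rewrite mulr1 subKr mulrC divfK// gt_eqF.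
Qed.

Lemma prodr_bool (R : realType) (I : finType) (b : I -> bool) :
  \prod_i (b i)%:R = [forall i, b i]%:R :> R.
Proof.
case: (boolP [forall i, b i]) => [/forallP h|]; first by rewrite big1// => i _; rewrite h.
by rewrite negb_forall => /existsP[i /negbTE h]; rewrite (bigD1 i)//= h mul0r.
Qed.

Lemma forall_ord2 (b : 'I_2 -> bool) : [forall i, b i] = b ord0 && b ord_max.
Proof.
apply/forallP/andP => [h //|[h0 h1] i].
by case: i => -[|[|//]] hi; [rewrite (_ : Ordinal hi = ord0)|rewrite (_ : Ordinal hi = ord_max)] => //; exact: val_inj.
Qed.

(** Summing over the possible common value [t] puts agreement of two vertices in product form, as
    needed for MAX-CUT, Ising and Coloring. *)
Lemma sum_agree (R : realType) (chi : finType) (y : {ffun 'I_2 -> chi}) :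
  \sum_t \prod_i (y i == t)%:R = (y ord0 == y ord_max)%:R :> R.
Proof.
under eq_bigr do rewrite prodr_bool forall_ord2.
rewrite (bigD1 (y ord0)) //= eqxx /= eq_sym big1 ?addr0// => t.
by rewrite eq_sym => /negbTE ->.
Qed.

(** * Independent sets: insertion bounds despite the hard constraint *)

Section IndependentSet.
Variables (R : realType) (lambda : R).
Hypothesis lambda_ge1 : 1 <= lambda.
Let lambda_gt0 : 0 < lambda. Proof. exact: lt_le_trans lambda_ge1. Qed.
Local Notation nu := (@node_weight R lambda (IndSet R)).
Local Notation w := (@edge_factor R lambda (IndSet R)).

Lemma indset_edge_factor a y :
  w a y = if (val (y ord0) == 1%N) && (val (y ord_max) == 1%N) then 0 else 1.
Proof. by rewrite /edge_factor /=; case: ifP => //; rewrite powRr0. Qed.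

Definition flip N (i : 'I_N) (x : {ffun 'I_N -> 'I_2}) : {ffun 'I_N -> 'I_2} :=
  [ffun k => if k == i then rev_ord (x k) else x k].

Lemma flipK N (i : 'I_N) : involutive (flip i).
Proof. by move=> x; apply/ffunP => k; rewrite !ffunE; case: eqP => // _; rewrite rev_ordK. Qed.

(* Removing a vertex from an independent set keeps it independent, so a vertex is occupied
   with probability at most lambda / (1 + lambda), whatever the hyperedges. *)
Lemma indset_flip_weight N (i : 'I_N) s (x : {ffun 'I_N -> 'I_2}) : val (x i) = 0%N ->
  config_weight nu w s (flip i x) <= lambda * config_weight nu w s x.
Proof.
move=> xi; rewrite /config_weight mulrA; apply: ler_pM.
- by apply: prodr_ge0 => k _; exact: powR_ge0.
- by apply: prodr_ge0 => e _; exact: edge_factor_ge0.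
- rewrite (bigD1 i) //= [in leRHS](bigD1 i) //= ffunE eqxx mulrA.
  rewrite (eq_bigr (fun k => nu (x k))); last by move=> k /negbTE ki; rewrite ffunE ki.
  apply: ler_wpM2r; first by apply: prodr_ge0 => k _; exact: powR_ge0.
  by rewrite /node_weight /= xi subn1 /= powRr1 ?(ltW lambda_gt0)// powRr0 mulr1.
- apply: ler_prod => e _; rewrite edge_factor_ge0 /edge_weight !indset_edge_factor !ffunE /=.
  have mono k : val (x k) == 1%N -> val (flip i x k) == 1%N.
    by rewrite ffunE; case: (k =P i) => [->|//]; rewrite xi.
  case: ifP => [_|hA]; first by case: ifP.
  case: ifP => [/andP[/mono h1 /mono h2]|//].
  by rewrite !ffunE in h1 h2; rewrite h1 h2 in hA.
Qed.

(** Configurations with the first endpoint [i] of [e] vacant satisfy [e], so their total weight [Z0]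
    survives its insertion. Flipping [i] shows that the others weigh at most [lambda * Z0]. The
    upper bound is that edge weights are at most 1. *)
Lemma indset_insertion_bounds : insertion_bounds nu w (1 + lambda)^-1 1.
Proof.
move=> N e s; have l0 : 0 < 1 + lambda by rewrite addr_gt0.
have cw0 s' x : 0 <= config_weight nu w s' x.
  by apply: config_weight_ge0 => *; [exact: powR_ge0 | exact: edge_factor_ge0].
have w01 (x : {ffun 'I_N -> 'I_2}) : 0 <= @edge_weight _ _ _ w N e x <= 1.
  by rewrite /edge_weight indset_edge_factor; case: ifP; rewrite lexx ler01.
apply/andP; split; last first.
  rewrite mul1r; apply: ler_sum => x _; rewrite config_weight_cons -[leRHS]mulr1.
  by apply: ler_wpM2l => //; case/andP: (w01 x).
rewrite mulrC ler_pdivrMr//.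
pose i := e.1 ord0.
rewrite {1}/pfun (bigID (fun x : {ffun 'I_N -> 'I_2} => val (x i) == 0%N)) /=.
set Z0 := \sum_(x | _) _.
have Z0le : Z0 <= pfun nu w (e :: s).
  rewrite /pfun (bigID (fun x : {ffun 'I_N -> 'I_2} => val (x i) == 0%N)) /=.
  rewrite -[leLHS]addr0; apply: lerD; last by apply: sumr_ge0.
  apply: ler_sum => x /eqP xi; rewrite config_weight_cons /edge_weight indset_edge_factor.
  by rewrite ffunE -/i (xi : val (x i) = 0%N) /= mulr1.
rewrite mulrDr mulr1; apply: lerD => //; rewrite mulrC.
apply: le_trans (ler_wpM2l (ltW lambda_gt0) Z0le).
rewrite (reindex (flip i)); last by apply: onW_bij; exists (flip i); exact: flipK.
rewrite /Z0 mulr_sumr (eq_bigl (fun x : {ffun 'I_N -> 'I_2} => val (x i) == 0%N)).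
  by apply: ler_sum => x /eqP; exact: indset_flip_weight.
by move=> x; rewrite /= ffunE eqxx /=; case: (x i) => -[|[|]].
Qed.
End IndependentSet.

Lemma model_bounds (R : realType) (lambda : R) (m : model R) : 1 <= lambda -> wf_model m ->
  exists kmin kmax : R,
    [/\ (0 < mq m)%N, 0 < kmin, replica_form (@edge_factor R lambda m)
      & insertion_bounds (@node_weight R lambda m) (@edge_factor R lambda m) kmin kmax] /\
    (nondecr_model m -> 1 <= kmin) /\ (nonincr_model m -> kmax <= 1).
Proof.
move=> l1 wf.
have l0 : 0 < lambda by exact: lt_le_trans l1.
(* Every model except independent set has two positive edge weights, which then serve as the
   insertion bounds. *)
have soft (T : finType) P (phi : T -> bool -> 'I_(mq m) -> bool) (wlo whi : R) :
    (0 < mq m)%N -> 0 < wlo -> wlo <= whi ->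
    (forall a y, @edge_factor R lambda m a y = if P a y then wlo else whi) ->
    (forall (a : {ffun 'I_(mK m) -> bool}) (y : {ffun 'I_(mK m) -> 'I_(mq m)}),
      \sum_t \prod_i (phi t (a i) (y i))%:R = (P a y)%:R :> R) ->
    [/\ (0 < mq m)%N, 0 < wlo, replica_form (@edge_factor R lambda m)
      & insertion_bounds (@node_weight R lambda m) (@edge_factor R lambda m) wlo whi].
  move=> q0 lo0 le wE PE; split => //.
    exact: replica_form_two_valued le (lt_le_trans lo0 le) wE PE.
  apply: insertion_bounds_pointwise => [c||a y]; first exact: powR_ge0.
    exact: ltW.
  by rewrite wE; case: ifP; rewrite lexx ?andbT ?le.
case: m wf soft => [||beta B|q|K|K] /= wf soft.
- exists (1 + lambda)^-1, 1; split => //; split => //.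
  + by rewrite invr_gt0 addr_gt0.
  + apply: (@replica_form_two_valued _ _ _ unit _
      (fun _ y => (val (y ord0) == 1%N) && (val (y ord_max) == 1%N))
      (fun _ _ c => val c == 1%N) 0 1) => //.
      exact: indset_edge_factor.
    by move=> a y; rewrite big_const card_unit /= addr0 prodr_bool forall_ord2.
  + exact: indset_insertion_bounds.
- exists 1, lambda; split => //.
  apply: (soft _ (fun _ y => y ord0 == y ord_max) (fun t _ c => c == t)) => // a y.
    rewrite /edge_factor /=; case: eqP => _ /=; by rewrite ?powRr0 ?powRr1 ?(ltW l0).
  exact: sum_agree.
- exists (lambda `^ (- beta)), (lambda `^ beta); split => //.
  apply: (soft _ (fun _ y => y ord0 == y ord_max) (fun t _ c => c == t)) => //.
  + exact: powR_gt0.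
  + by apply: ler_powR => //; lra.
  + by move=> a y; rewrite /edge_factor /=; case: eqP.
  + by move=> a y; exact: sum_agree.
- exists 1, lambda; split => //.
  apply: (soft _ (fun _ y => y ord0 == y ord_max) (fun t _ c => c == t)) => //.
  + exact: leq_trans wf.
  + move=> a y; rewrite /edge_factor /=; case: eqP => _ /=; by rewrite ?powRr0 ?powRr1 ?(ltW l0).
  + by move=> a y; exact: sum_agree.
- exists 1, lambda; split => //.
  apply: (soft unit (fun a y => [forall i, val (y i) == nat_of_bool (a i)])
     (fun _ b c => val c == nat_of_bool b)) => // a y.
    by rewrite /edge_factor /=; case: ifP => _; rewrite ?powRr0 ?powRr1 ?(ltW l0).
  by rewrite big_const card_unit /= addr0 prodr_bool.
- exists 1, lambda; split => //.
  (* The index [t] selects the sign vector or its complement, through exclusive or. *)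
  apply: (soft bool (fun a y => [forall i, val (y i) == nat_of_bool (a i)]
        || [forall i, val (y i) == nat_of_bool (~~ a i)])
     (fun t b c => val c == nat_of_bool (b (+) t))) => // a y.
    by rewrite /edge_factor /=; case: ifP => _; rewrite ?powRr0 ?powRr1 ?(ltW l0).
  rewrite big_bool /= !prodr_bool addrC.
  under eq_forallb do rewrite addbF.
  rewrite [X in _ + (nat_of_bool X)%:R](_ : _ = [forall i, val (y i) == nat_of_bool (~~ a i)]);
    last by apply: eq_forallb => i; rewrite addbT.
  case: (boolP [forall i, _ == nat_of_bool (a i)]) => [/forallP h|_]; last by rewrite add0r.
  (* The two penalised patterns disagree at slot 0, which exists as [2 <= K]; hence the indicator of
     their union is the sum of the indicators. *)
  suff -> : [forall i, val (y i) == nat_of_bool (~~ a i)] = false by rewrite addr0.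
  apply/negbTE/forallPn; exists (Ordinal (ltnW wf)); apply/eqP => e.
  by have := etrans (esym e) (eqP (h _)); case: (a _).
Qed.

Theorem theorem2 (R : realType) (lambda : R) (m : model R) :
  1 <= lambda -> wf_model m ->
  exists z : R -> R,
    (forall c : R, 0 < c -> forall eps : R, 0 < eps ->
       (fun N : nat =>
          uprob (fun g : sample m N (nedges c N) =>
                  eps < `| ln (Zpart lambda g) / N%:R - z c |)) @ \oo --> 0)
    /\ (exists L : R, forall c1 c2 : R, 0 < c1 -> 0 < c2 ->
          `| z c1 - z c2 | <= L * `| c1 - c2 |)
    /\ (nondecr_model m -> forall c1 c2 : R, 0 < c1 -> c1 <= c2 -> z c1 <= z c2)
    /\ (nonincr_model m -> forall c1 c2 : R, 0 < c1 -> c1 <= c2 -> z c2 <= z c1).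
Proof.
move=> l1 wf; have l0 : 0 < lambda by exact: lt_le_trans l1.
have [kmin [kmax [[q0 k0 hrep hins] [hnd hni]]]] := model_bounds l1 wf.
have [z [zlim zlip]] := model_scaling_limit l0 q0 k0 hrep hins.
exists z; split => //; split; [|split].
- exists (Num.max `|ln kmin| `|ln kmax|) => c1 c2.
  wlog c12 : c1 c2 / c1 <= c2 => [W|c10 _].
    have [/W//|/ltW/W h] := leP c1 c2 => c10 c20.
    by rewrite distrC [`|c1 - c2|]distrC; exact: h.
  have /andP[h1 h2] := zlip _ _ c10 c12.
  have d0 : 0 <= c2 - c1 by rewrite subr_ge0.
  rewrite distrC [`|c1 - c2|]distrC [`|c2 - c1|]ger0_norm// ler_norml; apply/andP; split.
    apply: le_trans h1; rewrite -mulNr; apply: ler_wpM2r => //.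
    by rewrite lerNl (le_trans (ler_norm _))// normrN le_max lexx.
  apply: le_trans h2 _; apply: ler_wpM2r => //.
  by rewrite (le_trans (ler_norm _))// le_max lexx orbT.
- move=> /hnd k1 c1 c2 c10 c12; rewrite -subr_ge0.
  have /andP[h _] := zlip _ _ c10 c12; apply: le_trans h.
  by rewrite mulr_ge0 ?subr_ge0// ln_ge0.
- move=> /hni k1 c1 c2 c10 c12; rewrite -subr_le0.
  have /andP[_ h] := zlip _ _ c10 c12; apply: le_trans h _.
  by rewrite mulr_le0_ge0 ?subr_ge0// ln_le0.
Qed.
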